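(* Let $\mathbb{F}$ be a field and let $\oslash$ be a uniform Kronecker quotient over $\mathbb{F}$. Then the Kronecker difference $\ominus$ induced by $\oslash$, i.e. $M\ominus B:=(M-I_m\otimes B)\oslash I_n$ for all $M\in\mathbb{F}_{mn}$, $B\in\mathbb{F}_n$ and $m,n\in\mathbb{N}$, is uniform.
   Context: $\mathbb{F}_m$ is the space of $m\times m$ matrices over $\mathbb{F}$, $\mathbb{N}$ is the set of positive integers, $\otimes$ is the Kronecker product, and $\mathbb{F}_m\otimes\mathbb{F}_n$ is identified with $\mathbb{F}_{mn}$. The Kronecker sum of $A\in\mathbb{F}_m$ and $B\in\mathbb{F}_n$ is $A\oplus B=A\otimes I_n+I_m\otimes B$. A Kronecker quotient is a family of operations $\oslash:\mathbb{F}_{mn}\times\mathbb{F}_n\to\mathbb{F}_m$, indexed by $m,n\in\mathbb{N}$, such that $(A\otimes B)\oslash B=A$ for all $A\in\mathbb{F}_m$ and all non-zero $B\in\mathbb{F}_n$, $m,n\in\mathbb{N}$. It is uniform if $(A\otimes C)\oslash B=A\otimes(C\oslash B)$ for all $A\in\mathbb{F}_m$, $B\in\mathbb{F}_n$, $C\in\mathbb{F}_p\otimes\mathbb{F}_n$, $m,n,p\in\mathbb{N}$, and $(A+B)\oslash C=(A\oslash C)+(B\oslash C)$, $(kA)\oslash C=k(A\oslash C)$ for all matrices $A,B,C$ and scalars $k\in\mathbb{F}$ whenever the operations are defined. A Kronecker difference is a family of operations $\ominus:\mathbb{F}_{mn}\times\mathbb{F}_n\to\mathbb{F}_m$, indexed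 by $m,n\in\mathbb{N}$, such that $(A\oplus B)\ominus B=A$ for all $A\in\mathbb{F}_m$, $B\in\mathbb{F}_n$, $m,n\in\mathbb{N}$. It is uniform if $(A\oplus C)\ominus B=A\oplus(C\ominus B)$ for all $A\in\mathbb{F}_m$, $B\in\mathbb{F}_n$, $C\in\mathbb{F}_p\otimes\mathbb{F}_n$ and $m,n,p\in\mathbb{N}$, and moreover $(A+B)\ominus(C+D)=(A\ominus C)+(B\ominus D)$ and $(kA)\ominus(kC)=k(A\ominus C)$ for all matrices $A,B,C,D$ and scalars $k\in\mathbb{F}$ whenever the operations are defined. *)

(* Defs.v *)
From mathcomp Require Import all_boot all_order all_algebra.
From mathcomp Require Export mxtens.

Set Implicit Arguments.
Unset Strict Implicit.
Unset Printing Implicit Defensive.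

Import GRing.Theory.
Local Open Scope ring_scope.

(* The Kronecker product is [tensmx] (notation [A *t B]) from mxtens, with the
   usual row-major indexing: entry (i * p + k, j * q + l) is A i j * B k l.     *)

(* The identification of F_m (x) (F_p (x) F_n) with (F_m (x) F_p) (x) F_n:
   entries are unchanged, only the dimension is rewritten by associativity.     *)
Definition kron_assoc (R : Type) (m p n : nat) (M : 'M[R]_(m * (p * n))) :
    'M[R]_(m * p * n) :=
  castmx (mulnA m p n, mulnA m p n) M.

Definition kron_sum (F : fieldType) (m n : nat) (A : 'M[F]_m) (B : 'M[F]_n) :
    'M[F]_(m * n) :=
  A *t (1%:M : 'M[F]_n) + (1%:M : 'M[F]_m) *t B.

(* A family of operations F_{mn} x F_n -> F_m.  The index set is the positive
   integers: the values at m = 0 or n = 0 are irrelevant, and every predicate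
   below only constrains positive dimensions.                                   *)
Definition kron_family (F : fieldType) : Type :=
  forall m n : nat, 'M[F]_(m * n) -> 'M[F]_n -> 'M[F]_m.

Definition kron_quotient (F : fieldType) (quo : kron_family F) : Prop :=
  forall m n : nat, (0 < m)%N -> (0 < n)%N ->
  forall (A : 'M[F]_m) (B : 'M[F]_n), B != 0 -> quo m n (A *t B) B = A.

Record uniform_kron_quotient (F : fieldType) (quo : kron_family F) : Prop :=
  UniformKronQuotient {
    ukq_quotient : kron_quotient quo;
    ukq_kron : forall m n p : nat, (0 < m)%N -> (0 < n)%N -> (0 < p)%N ->
      forall (A : 'M[F]_m) (B : 'M[F]_n) (C : 'M[F]_(p * n)),
      quo (m * p)%N n (kron_assoc (A *t C)) B = A *t quo p n C B;
    ukq_add : forall m n : nat, (0 < m)%N -> (0 < n)%N ->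
      forall (A B : 'M[F]_(m * n)) (C : 'M[F]_n),
      quo m n (A + B) C = quo m n A C + quo m n B C;
    ukq_scale : forall m n : nat, (0 < m)%N -> (0 < n)%N ->
      forall (k : F) (A : 'M[F]_(m * n)) (C : 'M[F]_n),
      quo m n (k *: A) C = k *: quo m n A C
  }.

Definition kron_difference (F : fieldType) (dif : kron_family F) : Prop :=
  forall m n : nat, (0 < m)%N -> (0 < n)%N ->
  forall (A : 'M[F]_m) (B : 'M[F]_n), dif m n (kron_sum A B) B = A.

Record uniform_kron_difference (F : fieldType) (dif : kron_family F) : Prop :=
  UniformKronDifference {
    ukd_difference : kron_difference dif;
    ukd_kron : forall m n p : nat, (0 < m)%N -> (0 < n)%N -> (0 < p)%N ->
      forall (A : 'M[F]_m) (B : 'M[F]_n) (C : 'M[F]_(p * n)),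
      dif (m * p)%N n (kron_assoc (kron_sum A C)) B = kron_sum A (dif p n C B);
    ukd_add : forall m n : nat, (0 < m)%N -> (0 < n)%N ->
      forall (A B : 'M[F]_(m * n)) (C D : 'M[F]_n),
      dif m n (A + B) (C + D) = dif m n A C + dif m n B D;
    ukd_scale : forall m n : nat, (0 < m)%N -> (0 < n)%N ->
      forall (k : F) (A : 'M[F]_(m * n)) (C : 'M[F]_n),
      dif m n (k *: A) (k *: C) = k *: dif m n A C
  }.

Definition induced_difference (F : fieldType) (quo : kron_family F) :
    kron_family F :=
  fun m n M B => quo m n (M - (1%:M : 'M[F]_m) *t B) (1%:M : 'M[F]_n).

(* Main.v *)
Require Import Defs.
From mathcomp Require Import all_boot all_order all_algebra.

(** Write [L M = M ⊘ I_n], a linear map. Since [I_(pn) = I_p ⊗ I_n] and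
    [I_(mp) ⊗ B = I_m ⊗ (I_p ⊗ B)],
    [(A ⊕ C) - I_(mp) ⊗ B = A ⊗ (I_p ⊗ I_n) + I_m ⊗ (C - I_p ⊗ B)],
    and applying [L] to the right tensor factors gives
    [A ⊗ I_p + I_m ⊗ (C ⊖ B) = A ⊕ (C ⊖ B)]. *)

Import GRing.Theory.
Local Open Scope ring_scope.

Section Tensmx.

Variable R : comPzRingType.

Lemma tensmxDr (m n p q : nat) (A : 'M[R]_(m, n)) (B C : 'M[R]_(p, q)) :
  A *t (B + C) = A *t B + A *t C.
Proof. by apply/matrixP => i j; rewrite !mxE mulrDr. Qed.

Lemma tensmxZr (m n p q : nat) (k : R) (A : 'M[R]_(m, n)) (B : 'M[R]_(p, q)) :
  A *t (k *: B) = k *: (A *t B).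
Proof. by apply/matrixP => i j; rewrite !mxE mulrCA. Qed.

Lemma tensmxBr (m n p q : nat) (A : 'M[R]_(m, n)) (B C : 'M[R]_(p, q)) :
  A *t (B - C) = A *t B - A *t C.
Proof. by rewrite tensmxDr -scaleN1r tensmxZr scaleN1r. Qed.

Lemma tensmx11 (m n : nat) :
  (1%:M : 'M[R]_m) *t (1%:M : 'M[R]_n) = 1%:M.
Proof.
apply/matrixP => i j.
case: (mxtens_indexP i) => i0 i1; case: (mxtens_indexP j) => j0 j1.
by rewrite tensmxE !mxE (can_eq (@mxtens_indexK m n)) xpair_eqE -natrM mulnb.
Qed.

(** Both indices have the value [(a * p + b) * n + c = a * (p * n) + (b * n + c)]; this makes the
    Kronecker product associative up to the cast. *)
Lemma mxtens_indexA (m p n : nat) (a : 'I_m) (b : 'I_p) (c : 'I_n) :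
  cast_ord (esym (mulnA m p n)) (mxtens_index (mxtens_index (a, b), c)) =
  mxtens_index (a, mxtens_index (b, c)).
Proof. by apply: val_inj; rewrite /= mulnDl addnA mulnA. Qed.

Lemma kron_assoc_tensmx (m p n : nat)
    (A : 'M[R]_m) (B : 'M[R]_p) (C : 'M[R]_n) :
  kron_assoc (A *t (B *t C)) = A *t B *t C.
Proof.
apply/matrixP => i j.
case: (mxtens_indexP i) => i' c; case: (mxtens_indexP i') => a b.
case: (mxtens_indexP j) => j' f; case: (mxtens_indexP j') => d e.
by rewrite castmxE !mxtens_indexA !tensmxE mulrA.
Qed.

Lemma kron_assocD (m p n : nat) (M N : 'M[R]_(m * (p * n))) :
  kron_assoc (M + N) = kron_assoc M + kron_assoc N.
Proof. by apply/matrixP => i j; rewrite !(castmxE, mxE). Qed.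

Lemma kron_assocB (m p n : nat) (M N : 'M[R]_(m * (p * n))) :
  kron_assoc (M - N) = kron_assoc M - kron_assoc N.
Proof. by apply/matrixP => i j; rewrite !(castmxE, mxE). Qed.

End Tensmx.

(** The identity of size [p * n] is kept split as [1%:M *t 1%:M], so that the quotient by the
    identity of size [n] can be evaluated on it. *)
Lemma kron_assoc_sumB (F : fieldType) (m p n : nat)
    (A : 'M[F]_m) (C : 'M[F]_(p * n)) (B : 'M[F]_n) :
  kron_assoc (kron_sum A C) - 1%:M *t B =
  kron_assoc (A *t (1%:M *t 1%:M)) + kron_assoc (1%:M *t (C - 1%:M *t B)).
Proof.
rewrite (tensmx11 F p n) tensmxBr kron_assocB kron_assoc_tensmx tensmx11 addrA.
by rewrite -kron_assocD.
Qed.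

Lemma scalar_mx1_neq0 (R : nzRingType) (n : nat) :
  (0 < n)%N -> (1%:M : 'M[R]_n) != 0.
Proof. by case: n => // n _; apply: matrix_nonzero1. Qed.

Theorem proposition1 (F : fieldType) (quo : kron_family F)
  (quo_uniform : uniform_kron_quotient quo) :
  uniform_kron_difference (induced_difference quo).
Proof.
case: quo_uniform => quoK quo_kron quoD quoZ.
rewrite /induced_difference; split.
- move=> m n m0 n0 A B.
  (* Subtracting [1%:M *t B] from [kron_sum A B] leaves [A *t 1%:M]. *)
  by rewrite addrK quoK ?scalar_mx1_neq0.
- move=> m n p m0 n0 p0 A B C.
  have mp0 : (0 < m * p)%N by rewrite muln_gt0 m0.
  by rewrite kron_assoc_sumB (quoD _ _ mp0 n0) !quo_kron // quoK ?scalar_mx1_neq0.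
- move=> m n m0 n0 A B C D.
  (* The divisor is the identity on both sides, so joint additivity reduces to additivity of [quo]
     in its first argument. *)
  by rewrite -quoD // tensmxDr opprD addrACA.
- move=> m n m0 n0 k A C.
  by rewrite tensmxZr -scalerBr quoZ.
Qed.
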